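(* Let $R:=\mathsf S_{\mathfrak M}\operatorname{Del}N^{\star}_{\mathfrak H^{+}}N_{\mathfrak H^{+}}:\mathfrak H\to\mathbf{Gra}$. If $\phi:G\to G'$ is a morphism in $\mathfrak H$, then \begin{itemize} \item $V(R(G))=V(G)$, \item $E(R(G))=\{\{v,w\}:\exists e\in E(G)\ (\{v,w\}\subseteq\epsilon_G(e))\}$, \item $R(\phi)=V(\phi)$. \end{itemize}
   Context: Juxtaposition of functors denotes composition. $\mathcal P$ is the covariant power-set functor, $\mathcal P(f)(A)=\{f(x):x\in A\}$. A set-system hypergraph is a triple $G=(E(G),\epsilon_G,V(G))$ with $E(G),V(G)$ sets and $\epsilon_G:E(G)\to\mathcal P(V(G))$ a function. $\mathfrak H$: set-system hypergraphs, with morphisms $\phi:G\to H$ the pairs of functions $E(\phi):E(G)\to E(H)$, $V(\phi):V(G)\to V(H)$ satisfying $\epsilon_H(E(\phi)(e))=\mathcal P(V(\phi))(\epsilon_G(e))$ for all $e$. $\mathfrak H^{+}$: the same objects, with weak set-system homomorphisms, i.e. pairs $(E^{+}(\phi),V^{+}(\phi))$ of functions satisfying only $\mathcal P(V^{+}(\phi))(\epsilon_G(e))\subseteq\epsilon_H(E^{+}(\phi)(e))$ for all $e$. $N_{\mathfrak H^{+}}:\mathfrak H\to\mathfrak H^{+}$ is the inclusion. $\mathfrak M$: the full subcategory of $\mathfrak H$ of multigraphs, i.e. those $G$ with $1\le\operatorname{card}(\epsilon_G(e))\le2$ for every edge $e$. $\mathbf{Gra}$: objects $(V(G),E(G))$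 with $E(G)\subseteq\mathcal P(V(G))$ and $1\le\operatorname{card}(A)\le2$ for all $A\in E(G)$; morphisms are functions $f:V(G)\to V(G')$ with $\mathcal P(f)(A)\in E(G')$ for all $A\in E(G)$. $N^{\star}_{\mathfrak H^{+}}:\mathfrak H^{+}\to\mathfrak H$ (right adjoint of $N_{\mathfrak H^{+}}$, simplicial replacement): $N^{\star}_{\mathfrak H^{+}}(G)$ has vertex set $V(G)$, edge set $\{(e,A)\in E(G)\times\mathcal P(V(G)):A\subseteq\epsilon_G(e)\}$, and endpoint map $(e,A)\mapsto A$; on morphisms it acts by $V^{+}(\phi)$ on vertices and $(e,A)\mapsto(E^{+}(\phi)(e),\mathcal P(V^{+}(\phi))(A))$ on edges. $\operatorname{Del}:\mathfrak H\to\mathfrak M$ (right adjoint of the inclusion): keeps all vertices and exactly the edges $e$ with $1\le\operatorname{card}(\epsilon_G(e))\le 2$, and restricts morphisms accordingly. $\mathsf S_{\mathfrak M}:\mathfrak M\to\mathbf{Gra}$ (simplification): $\mathsf S_{\mathfrak M}(G)=(V(G),\{\epsilon_G(e):e\in E(G)\})$ and $\mathsf S_{\mathfrak M}(\phi)=V(\phi)$. *)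

(* Defs.v *)
From mathcomp Require Import all_boot.
From mathcomp Require Import boolp classical_sets functions cardinality.

Set Implicit Arguments.
Unset Strict Implicit.
Unset Printing Implicit Defensive.

Local Open Scope classical_set_scope.
Local Open Scope card_scope.

(* Sets are types, subsets of X are terms of [set X], and the covariant power-set
   functor is the direct image: P(f)(A) is [f @` A]. *)

Record category := Category {
  obj :> Type;
  hom : obj -> obj -> Type;
  idm : forall A, hom A A;
  comp : forall A B C, hom B C -> hom A B -> hom A C;
  comp_idl : forall A B (f : hom A B), comp (idm B) f = f;
  comp_idr : forall A B (f : hom A B), comp f (idm A) = f;
  comp_assoc : forall A B C D (h : hom C D) (g : hom B C) (f : hom A B),
    comp h (comp g f) = comp (comp h g) f
}.
Arguments hom {c} _ _.
Arguments idm {c} A.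
Arguments comp {c A B C} g f.

Record functor (C D : category) := Functor {
  fobj :> C -> D;
  fmap : forall A B, hom A B -> hom (fobj A) (fobj B);
  fmap_id : forall A, fmap (idm A) = idm (fobj A);
  fmap_comp : forall A B X (g : hom B X) (f : hom A B),
    fmap (comp g f) = comp (fmap g) (fmap f)
}.
Arguments fmap {C D} F {A B} f : rename.

Definition functor_comp (C D X : category) (G : functor D X) (F : functor C D) :
  functor C X.
Proof.
refine (@Functor C X (fun A => G (F A))
  (fun A B f => fmap G (fmap F f)) _ _).
- by move=> A; rewrite !fmap_id.
- by move=> A B Y g f; rewrite !fmap_comp.
Defined.

Definition full_subcategory (C : category) (P : C -> Prop) : category :=
  @Category {A : C | P A} (fun A B => hom (sval A) (sval B))
    (fun A => idm (sval A)) (fun A B X g f => comp g f)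
    (fun A B f => comp_idl f) (fun A B f => comp_idr f)
    (fun A B X Y h g f => comp_assoc h g f).

Record hypergraph := Hypergraph {
  hE : Type;
  hV : Type;
  endpt : hE -> set hV
}.
Arguments endpt {h} e : rename.

Record hyp_hom (G H : hypergraph) := HypHom {
  homE : hE G -> hE H;
  homV : hV G -> hV H;
  hom_endpt : forall e, endpt (homE e) = homV @` endpt e
}.

Record whyp_hom (G H : hypergraph) := WHypHom {
  whomE : hE G -> hE H;
  whomV : hV G -> hV H;
  whom_endpt : forall e, whomV @` endpt e `<=` endpt (whomE e)
}.

Arguments hom_endpt {G H} _ e.
Arguments whom_endpt {G H} _ e.

Lemma hyp_hom_eq G H (f g : hyp_hom G H) :
  homE f = homE g -> homV f = homV g -> f = g.
Proof.
case: f g => fE fV fP [gE gV gP] /= eE eV; case: _ / eE gP => gP.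
by case: _ / eV gP => gP; congr HypHom; apply: Prop_irrelevance.
Qed.

Lemma whyp_hom_eq G H (f g : whyp_hom G H) :
  whomE f = whomE g -> whomV f = whomV g -> f = g.
Proof.
case: f g => fE fV fP [gE gV gP] /= eE eV; case: _ / eE gP => gP.
by case: _ / eV gP => gP; congr WHypHom; apply: Prop_irrelevance.
Qed.

Definition hyp_id G : hyp_hom G G :=
  @HypHom G G id id (fun e => esym (image_id (endpt e))).

Definition hyp_comp G H K (g : hyp_hom H K) (f : hyp_hom G H) : hyp_hom G K.
Proof.
refine (@HypHom G K (homE g \o homE f) (homV g \o homV f) _).
by move=> e /=; rewrite !hom_endpt image_comp.
Defined.

Definition whyp_id G : whyp_hom G G.
Proof. by refine (@WHypHom G G id id _) => e; rewrite image_id. Defined.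

Definition whyp_comp G H K (g : whyp_hom H K) (f : whyp_hom G H) : whyp_hom G K.
Proof.
refine (@WHypHom G K (whomE g \o whomE f) (whomV g \o whomV f) _).
move=> e _ [x ex <-]; apply: whom_endpt; exists (whomV f x) => //.
by apply: whom_endpt; exists x.
Defined.

Definition Hyp : category.
Proof.
by refine (@Category hypergraph hyp_hom hyp_id hyp_comp _ _ _) => *;
  apply: hyp_hom_eq.
Defined.

Definition WHyp : category.
Proof.
by refine (@Category hypergraph whyp_hom whyp_id whyp_comp _ _ _) => *;
  apply: whyp_hom_eq.
Defined.

Definition hyp_weaken G H (f : hyp_hom G H) : whyp_hom G H.
Proof.
by refine (@WHypHom G H (homE f) (homV f) _) => e; rewrite hom_endpt.
Defined.

Definition N_WHyp : functor Hyp WHyp.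
Proof.
by refine (@Functor Hyp WHyp (fun G => G) hyp_weaken _ _) => *;
  apply: whyp_hom_eq.
Defined.

Definition card12 (T : Type) (A : set T) : Prop :=
  `I_1 #<= A /\ A #<= `I_2.

Lemma card_ge1_nonempty (T : Type) (A : set T) : `I_1 #<= A <-> A !=set0.
Proof.
split=> [A1|[x Ax]].
- apply/set0P/negP => /eqP A0; move: A1; rewrite A0 => /card_le0P.
  by rewrite II1 => /seteqP[+ _] => /(_ 0); apply.
- rewrite -(card_le_eql (@card_set1 _ x)); apply: subset_card_le.
  by move=> _ ->.
Qed.

Lemma card12_image (T U : Type) (f : T -> U) (A : set T) :
  card12 A -> card12 (f @` A).
Proof.
move=> [/card_ge1_nonempty A1 A2]; split.
- exact/card_ge1_nonempty/image_nonempty.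
- exact: card_le_trans (card_image_le f A) A2.
Qed.

Definition multigraph (G : hypergraph) : Prop :=
  forall e : hE G, card12 (endpt e).

Definition Mgr : category := @full_subcategory Hyp multigraph.

Record graph := Graph {
  gV : Type;
  gE : set (set gV);
  gE_card : forall A, gE A -> card12 A
}.

Record gra_hom (G H : graph) := GraHom {
  gfun :> gV G -> gV H;
  gfun_edge : forall A, gE A -> gE (gfun @` A)
}.

Lemma gra_hom_eq G H (f g : gra_hom G H) : gfun f = gfun g -> f = g.
Proof.
case: f g => f fP [g gP] /= e; case: _ / e gP => gP.
by congr GraHom; apply: Prop_irrelevance.
Qed.

Definition gra_id G : gra_hom G G.
Proof. by refine (@GraHom G G id _) => A; rewrite image_id. Defined.

Definition gra_comp G H K (g : gra_hom H K) (f : gra_hom G H) : gra_hom G K.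
Proof.
refine (@GraHom G K (gfun g \o gfun f) _) => A AG.
by rewrite -image_comp; do 2 apply: gfun_edge.
Defined.

Definition Gra : category.
Proof.
by refine (@Category graph gra_hom gra_id gra_comp _ _ _) => *;
  apply: gra_hom_eq.
Defined.

Definition replacement_obj (G : hypergraph) : hypergraph :=
  @Hypergraph {p : hE G * set (hV G) | p.2 `<=` endpt p.1} (hV G)
    (fun p => (sval p).2).

Lemma replacement_edge G H (f : whyp_hom G H) (p : hE (replacement_obj G)) :
  whomV f @` (sval p).2 `<=` endpt (whomE f (sval p).1).
Proof.
by move=> _ [x px <-]; apply: whom_endpt; exists x => //; apply: (svalP p).
Qed.

Arguments replacement_edge {G H} f p.

Definition replacement_map G H (f : whyp_hom G H) :
    hyp_hom (replacement_obj G) (replacement_obj H) :=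
  @HypHom (replacement_obj G) (replacement_obj H)
    (fun p => exist _ (whomE f (sval p).1, whomV f @` (sval p).2)
                (replacement_edge f p))
    (whomV f) (fun=> erefl).

Definition Nstar_WHyp : functor WHyp Hyp.
Proof.
refine (@Functor WHyp Hyp replacement_obj replacement_map _ _).
- move=> G; apply: hyp_hom_eq => //; apply: funext => -[[e A] eA].
  by apply: eq_exist; rewrite /= image_id.
- move=> G H K g f; apply: hyp_hom_eq => //; apply: funext => -[[e A] eA].
  by apply: eq_exist; rewrite /= image_comp.
Defined.

Definition Del_hyp (G : hypergraph) : hypergraph :=
  @Hypergraph {e : hE G | card12 (endpt e)} (hV G) (fun e => endpt (sval e)).

Definition Del_obj (G : hypergraph) : Mgr :=
  exist multigraph (Del_hyp G) (fun e => svalP e).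

Lemma Del_edge G H (f : hyp_hom G H) (e : hE (Del_hyp G)) :
  card12 (endpt (homE f (sval e))).
Proof. by case: e => e ecard /=; rewrite hom_endpt; apply: card12_image. Qed.

Arguments Del_edge {G H} f e.

Definition Del_map G H (f : hyp_hom G H) : hyp_hom (Del_hyp G) (Del_hyp H) :=
  @HypHom (Del_hyp G) (Del_hyp H)
    (fun e => exist _ (homE f (sval e)) (Del_edge f e))
    (homV f) (fun e => hom_endpt f (sval e)).

Definition Del : functor Hyp Mgr.
Proof.
refine (@Functor Hyp Mgr Del_obj Del_map _ _).
- move=> G; apply: hyp_hom_eq => //; apply: funext => -[e ecard].
  exact: eq_exist.
- move=> G H K g f; apply: hyp_hom_eq => //; apply: funext => -[e ecard].
  exact: eq_exist.
Defined.

Definition simplify_obj (G : Mgr) : graph.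
Proof.
refine (@Graph (hV (sval G)) (range (@endpt (sval G))) _).
by move=> _ [e _ <-]; apply: (svalP G).
Defined.

Definition simplify_map (G H : Mgr) (f : hyp_hom (sval G) (sval H)) :
  gra_hom (simplify_obj G) (simplify_obj H).
Proof.
refine (@GraHom (simplify_obj G) (simplify_obj H) (homV f) _).
by move=> _ [e _ <-]; exists (homE f e) => //; rewrite hom_endpt.
Defined.

Definition S_Mgr : functor Mgr Gra.
Proof.
by refine (@Functor Mgr Gra simplify_obj simplify_map _ _) => *;
  apply: gra_hom_eq.
Defined.

Definition R : functor Hyp Gra :=
  functor_comp S_Mgr (functor_comp Del (functor_comp Nstar_WHyp N_WHyp)).

(* Main.v *)
Require Import Defs.
From mathcomp Require Import all_boot.
From mathcomp Require Import boolp classical_sets functions cardinality.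

Local Open Scope classical_set_scope.

(** An edge of [R G] is the endpoint set of an edge [(e, A)] of the simplicial replacement that
    survives [Del]: a set [A] inside [endpt e] with one or two elements. By [card12P] these are the
    pairs [[set v; w]], with [v = w] allowed. Vertices and vertex maps pass unchanged through all
    four functors. *)

Lemma card12P (T : Type) (A : set T) :
  card12 A <-> exists v w, A = [set v; w].
Proof.
split=> [[/card_ge1_nonempty[v Av] /pcard_leP[f]]|[v [w ->]]].
- have f2 x : A x -> f x < 2 by move=> Ax; apply: (@funS _ _ _ _ f).
  have finj x y : A x -> A y -> f x = f y -> x = y.
    by move=> Ax Ay; apply: (@inj _ _ _ f); rewrite inE.
  have [[w [Aw wv]]|Asub] := pselect (exists w, A w /\ w <> v).
  + exists v, w; apply/seteqP; split=> [x Ax|x [->|->] //].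
    have fwv : f w <> f v by move=> /(finj _ _ Aw Av).
    have [fxv|fxv] := pselect (f x = f v); first by left; exact: finj.
    (* Pigeonhole: [f x] and [f w] both differ from [f v] and all three are below 2, so
       [f x = f w]. *)
    right; apply: finj => //; move: (f2 x Ax) (f2 v Av) (f2 w Aw) fwv fxv.
    by case: (f x) (f v) (f w) => [|[|?]] [|[|?]] [|[|?]].
  + exists v, v; rewrite setUid; apply/seteqP; split=> [x Ax|_ ->//].
    by apply: contrapT => xv; apply: Asub; exists x.
- split; first by apply/card_ge1_nonempty; exists v; left.
  (* As an image of [I_2], the pair has at most two elements, without deciding whether [v = w]. *)
  suff -> : [set v; w] = (fun i => if i is 0 then v else w) @` `I_2.
    exact: card_image_le.
  apply/seteqP; split=> [x [->|->]|_ [[|i] _ <-]].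
  + by exists 0.
  + by exists 1.
  + by left.
  + by right.
Qed.

(* The last two equations typecheck because [gV (R G)] and [hV G] are convertible. *)
Theorem lemma4p6 (G G' : Hyp) (phi : hom G G') :
  [/\ gV (R G) = hV G,
      gE (g := R G) =
        [set A | exists v w : hV G, A = [set v; w] /\
                   exists e : hE G, [set v; w] `<=` endpt e]
    & gfun (fmap R phi) = homV phi].
Proof.
split=> //; apply/seteqP; split=> [_ [[[[e A] /= eA] /= A12] _ <-] /=|].
- have [v [w AE]] := (card12P _ _).1 A12.
  by exists v, w; split=> //; exists e; rewrite -AE.
- move=> A /= [v [w [-> [e evw]]]].
  have A12 : card12 [set v; w] by apply/card12P; exists v, w.
  (* The inner [exist] is an edge of the replacement; the outer one certifies that [Del] keeps
     it. *)
  by exists (exist _ (exist _ (e, [set v; w]) evw) A12).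
Qed.
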